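(* Let $\mathcal S$ be a set of random variables and let $\rho$ be a normalized convex risk measure on $\mathcal L$ satisfying $s_\rho<\infty$, such that $\{X,-X,|X|\}\subseteq\mathcal L$ for every $X\in\mathcal S$. The following are equivalent. (i) $\rho(X)$ and $\rho(-X)$ are both bounded for $X\in\mathcal S$. (ii) $\rho(|X|)$ is bounded for $X\in\mathcal S$. In particular, this equivalence holds for $\rho=\rho_h$ (on $\mathcal L=L^1$, with $\mathcal S\subseteq L^1$) whenever $h\in\mathcal D$ is concave and not the identity on $[0,1]$.
   Context: Fix an atomless probability space $(\Omega,\mathcal F,\mathbb P)$; random variables are real-valued and almost surely equal ones are identified; $L^1$ is the set of integrable random variables. Write $x\vee y=\max\{x,y\}$. $\mathcal L$ is a convex cone of random variables containing all constants. A risk measure on $\mathcal L$ is a map $\rho:\mathcal L\to(-\infty,\infty]$ that is finite on constants. It is a convex risk measure if it satisfies monotonicity ($\rho(X)\le\rho(Y)$ if $X\le Y$), cash invariance ($\rho(X+c)=\rho(X)+c$ for $c\in\mathbb R$) and convexity ($\rho(\lambda X+(1-\lambda)Y)\le\lambda\rho(X)+(1-\lambda)\rho(Y)$ for $\lambda\in(0,1)$). It is normalized if $\rho(0)=0$. The folding score of $\rho$ is $$s_\rho=\sup_{X}\frac{\rho(|X|)}{|\rho(X)|\vee|\rho(-X)|},$$ the supremum being over those $X\in\mathcal L$ for which the ratio makes sense (i.e. $-X,|X|\in\mathcal L$), with the conventions $\infty/\infty=1$, $0/0=1$, and $a/0=\infty$ for $a>0$. ''Bounded for $X\in\mathcal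 S$'' means that the set of values over $X\in\mathcal S$ is a bounded subset of $\mathbb R$ (in particular the values are finite). $\mathcal D$ is the set of (non-strictly) increasing functions $h:[0,1]\to[0,1]$ with $h(0)=0$, $h(1)=1$. For concave $h\in\mathcal D$, the distortion risk measure $\rho_h:L^1\to(-\infty,\infty]$ is $$\rho_h(X)=\int_0^\infty h(\mathbb P(X>x))\,dx+\int_{-\infty}^0\big(h(\mathbb P(X>x))-1\big)\,dx .$$ *)

(* Defs.v *)
From HB Require Import structures.
From mathcomp Require Import all_boot all_order all_algebra.
From mathcomp Require Import all_classical all_reals all_analysis.
From mathcomp Require Import measurable_realfun.

Set Implicit Arguments.
Unset Strict Implicit.
Unset Printing Implicit Defensive.

Import Order.TTheory GRing.Theory Num.Theory.
Import numFieldNormedType.Exports.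

Local Open Scope classical_set_scope.
Local Open Scope ring_scope.

Definition atomless d (T : measurableType d) (R : realType)
    (P : probability T R) : Prop :=
  forall A : set T, measurable A -> (0 < P A)%E ->
    exists B : set T, [/\ measurable B, B `<=` A, (0 < P B)%E & (P B < P A)%E].

(* Random variables are represented by measurable functions. Almost sure
   identification is rendered by requiring sets of random variables and risk
   measures to be compatible with almost sure equality. *)
Definition abs_rv d (T : measurableType d) (R : realType)
  (X : {mfun T >-> R}) : {mfun T >-> R} := @Num.norm R R \o X.

Record rv_convex_cone d (T : measurableType d) (R : realType)
    (P : probability T R) (L : set {mfun T >-> R}) : Prop := RVConvexCone {
  cone_ae : forall X Y : {mfun T >-> R},
    {ae P, forall w, X w = Y w} -> L X -> L Y ;
  cone_scale : forall (a : R) (X : {mfun T >-> R}), 0 < a -> L X -> L (a *: X) ;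
  cone_add : forall X Y : {mfun T >-> R}, L X -> L Y -> L (X + Y) ;
  cone_cst : forall c : R, L (cst c) }.

(* A risk measure on [L] is given by a total function on random variables whose
   values outside [L] are irrelevant. *)
Record risk_measure d (T : measurableType d) (R : realType)
    (P : probability T R) (L : set {mfun T >-> R})
    (rho : {mfun T >-> R} -> \bar R) : Prop := RiskMeasure {
  risk_ae : forall X Y : {mfun T >-> R}, L X -> L Y ->
    {ae P, forall w, X w = Y w} -> rho X = rho Y ;
  risk_gtNy : forall X : {mfun T >-> R}, L X -> (-oo < rho X)%E ;
  risk_cst : forall c : R, rho (cst c) \is a fin_num }.

Record convex_risk_measure d (T : measurableType d) (R : realType)
    (P : probability T R) (L : set {mfun T >-> R})
    (rho : {mfun T >-> R} -> \bar R) : Prop := ConvexRiskMeasure {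
  convex_risk_is_risk : risk_measure P L rho ;
  risk_monotone : forall X Y : {mfun T >-> R}, L X -> L Y ->
    {ae P, forall w, X w <= Y w} -> (rho X <= rho Y)%E ;
  risk_cash : forall (X : {mfun T >-> R}) (c : R), L X ->
    rho (X + cst c) = (rho X + c%:E)%E ;
  risk_convex : forall (X Y : {mfun T >-> R}) (l : R), L X -> L Y ->
    0 < l < 1 ->
    (rho (l *: X + (1 - l) *: Y)%R
      <= l%:E * rho X + (1 - l)%R%:E * rho Y)%E }.

Definition normalized d (T : measurableType d) (R : realType)
  (rho : {mfun T >-> R} -> \bar R) : Prop := rho (cst 0) = 0%E.

(* Outside of the indeterminate cases 0/0 and oo/oo, the division of extended
   reals already satisfies a/0 = +oo for a > 0, and a/+oo = 0 for a finite. *)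
Definition folding_ratio (R : realType) (a b : \bar R) : \bar R :=
  if (a == 0%E) && (b == 0%E) || (a == +oo%E) && (b == +oo%E) then 1%E
  else (a / b)%E.

Definition folding_score d (T : measurableType d) (R : realType)
    (L : set {mfun T >-> R}) (rho : {mfun T >-> R} -> \bar R) : \bar R :=
  ereal_sup
    [set folding_ratio (rho (abs_rv X)) (maxe `|rho X| `|rho (- X)%R|)%E
      | X in [set X : {mfun T >-> R} | [/\ L X, L (- X) & L (abs_rv X)]]].

(* The bound is a real number, so this forces the values to be finite. *)
Definition bounded_for (R : realType) (I : Type) (S : set I)
    (f : I -> \bar R) : Prop :=
  exists M : R, forall X, S X -> (`|f X| <= M%:E)%E.

Definition L1 d (T : measurableType d) (R : realType) (P : probability T R) :
  set {mfun T >-> R} := [set X : {mfun T >-> R} | (X : T -> R) \in Lfun P 1%E].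

(* Only the values of [h] on [0, 1] matter. *)
Record distortion (R : realType) (h : R -> R) : Prop := Distortion {
  distortion_itv : forall x, 0 <= x <= 1 -> 0 <= h x <= 1 ;
  distortion_mono : {in `[0, 1] &, {homo h : x y / x <= y}} ;
  distortion0 : h 0 = 0 ;
  distortion1 : h 1 = 1 }.

Definition concave_distortion (R : realType) (h : R -> R) : Prop :=
  distortion h /\ convex_function (`[0, 1]%classic : set R^o) (\- h).

Definition distortion_risk_measure d (T : measurableType d) (R : realType)
    (P : probability T R) (h : R -> R) (X : {mfun T >-> R}) : \bar R :=
  (\int[@lebesgue_measure R]_(x in `[0%R, +oo[)
      (h (fine (P [set w | (x < X w)%R])))%:E
   + \int[@lebesgue_measure R]_(x in `]-oo, 0%R])
      (h (fine (P [set w | (x < X w)%R])) - 1)%:E)%E.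

(* Main.v *)
(** For a convex risk measure, convexity gives [0 <= rho X + rho (- X)], so that
    both [rho X] and [rho (- X)] are dominated in absolute value by
    [rho `|X|]; the converse domination is finiteness of the folding score.

    For [rho_h], put [h' p = 1 - h (1 - p)]. Then [rho_h X] is the integral over
    [x >= 0] of [h (P (X > x)) - h' (P (- X > x))], and [h' <= id <= h]. One of
    [P (X > 0)], [P (- X > 0)] is at most 1/2, and on [[0, 1/2]] concavity gives
    [h' <= theta h] with [theta = (1 - h(1/2)) / h(1/2) < 1] as soon as [h] is
    not the identity. Hence the smaller of the two tails can be recovered from
    [rho_h X + rho_h (- X)], and then so can the other one. *)

Require Import Defs.
From HB Require Import structures.
From mathcomp Require Import all_boot all_order all_algebra.
From mathcomp Require Import all_classical all_reals all_analysis.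
From mathcomp Require Import measurable_realfun.
From mathcomp Require Import ring lra.

Set Implicit Arguments.
Unset Strict Implicit.
Unset Printing Implicit Defensive.

Import Order.TTheory GRing.Theory Num.Theory.
Import numFieldNormedType.Exports.

Local Open Scope classical_set_scope.
Local Open Scope ring_scope.

(** * Slope inequalities for a concave distortion and its dual *)

Section concave_distortion.
Context (R : realType) (h : R -> R).
Hypothesis ch : concave_distortion h.

Definition dual_distortion (x : R) : R := 1 - h (1 - x).

Let h0 : h 0 = 0. Proof. exact: (distortion0 ch.1). Qed.
Let h1 : h 1 = 1. Proof. exact: (distortion1 ch.1). Qed.

Let ratio_itv (x y : R) : 0 <= x -> x <= y -> 0 < y -> 0 <= x / y <= 1.
Proof.
by move=> x0 xy y0; rewrite divr_ge0// ?(ltW y0)//= ler_pdivrMr// mul1r.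
Qed.

Lemma concave_distortion_conv (x y t : R) :
  0 <= x <= 1 -> 0 <= y <= 1 -> 0 <= t <= 1 ->
  t * h x + (1 - t) * h y <= h (t * x + (1 - t) * y).
Proof.
move=> x01 y01 /andP[t0 t1].
have := ch.2 (Itv01 t0 t1) x y.
rewrite !inE /= !in_itv /= => /(_ x01 y01).
by rewrite convRE /= /unstable.onem; lra.
Qed.

(** The slope [h x / x] decreases, since [x] is the convex combination of [y] and 0 with weight
    [x / y] on [y], and [h 0 = 0]. The cross-multiplied form covers [y = 0]. *)
Lemma concave_distortion_ratio (x y : R) :
  0 <= x -> x <= y -> y <= 1 -> x * h y <= y * h x.
Proof.
move=> x0 xy y1; have [y0|y0] := eqVneq y 0.
  by have -> : x = 0 by [lra]; rewrite y0 !mul0r.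
have {}y0 : 0 < y by rewrite lt_neqAle eq_sym y0 (le_trans x0).
have := @concave_distortion_conv y 0 (x / y).
rewrite h0 !mulr0 !addr0 divfK ?gt_eqF// => H.
rewrite -ler_pdivrMl// mulrA (mulrC _ x).
by apply: H; [rewrite y1 ltW|rewrite lexx ler01|exact: ratio_itv].
Qed.

Lemma concave_distortion_ge_id (x : R) : 0 <= x <= 1 -> x <= h x.
Proof.
move=> /andP[x0 x1].
by have := concave_distortion_ratio x0 x1 (lexx 1); rewrite h1; lra.
Qed.

(** Sum of the slope comparisons of [x] and of [y] with [x + y]. *)
Lemma concave_distortion_subadd (x y : R) : 0 <= x -> 0 <= y -> x + y <= 1 ->
  h (x + y) <= h x + h y.
Proof.
move=> x0 y0 xy1; have [s0|s0] := eqVneq (x + y) 0.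
  by have [-> ->] : x = 0 /\ y = 0 by [lra]; rewrite addr0 h0 addr0.
have {}s0 : 0 < x + y by rewrite lt_neqAle eq_sym s0 addr_ge0.
rewrite -(ler_pM2l s0).
have := @concave_distortion_ratio x (x + y) x0.
have := @concave_distortion_ratio y (x + y) y0.
by rewrite lerDl lerDr; nra.
Qed.

(** The dual is convex and vanishes at 0, so its slope increases: [1 - x] is the convex combination
    of [1 - y] and 1 with weight [x / y] on [1 - y]. *)
Lemma dual_distortion_ratio (x y : R) : 0 <= x -> x <= y -> y <= 1 ->
  y * dual_distortion x <= x * dual_distortion y.
Proof.
rewrite /dual_distortion => x0 xy y1; have [y0|y0] := eqVneq y 0.
  by have -> : x = 0 by [lra]; rewrite y0 !mul0r.
have {}y0 : 0 < y by rewrite lt_neqAle eq_sym y0 (le_trans x0).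
have := @concave_distortion_conv (1 - y) 1 (x / y).
have -> : x / y * (1 - y) + (1 - x / y) * 1 = 1 - x by field; rewrite gt_eqF.
rewrite h1 mulr1 => H.
have {H} : x / y * h (1 - y) + (1 - x / y) <= h (1 - x).
  apply: H; [lra|by rewrite ler01 lexx|exact: ratio_itv].
rewrite -(ler_pM2l y0) mulrDr mulrBr mulr1 (mulrCA y x) divff ?gt_eqF// mulr1.
rewrite mulrA (mulrCA y x) divff ?gt_eqF// mulr1.
by lra.
Qed.

Lemma dual_distortion_le (x : R) : 0 <= x <= 1 -> dual_distortion x <= h x.
Proof.
move=> /andP[x0 x1]; rewrite /dual_distortion.
have := @concave_distortion_ge_id x; have := @concave_distortion_ge_id (1 - x).
by lra.
Qed.

Lemma dual_distortion_ge0 (x : R) : 0 <= x <= 1 -> 0 <= dual_distortion x.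
Proof.
move=> /andP[x0 x1]; rewrite /dual_distortion subr_ge0.
by have /andP[] : 0 <= h (1 - x) <= 1 by [apply: (distortion_itv ch.1); lra].
Qed.

Lemma concave_distortion_half : ~ (forall x, 0 <= x <= 1 -> h x = x) ->
  2^-1 < h 2^-1.
Proof.
move=> hid; rewrite ltNge; apply/negP => hh; apply: hid => x /andP[x0 x1].
have xh : x <= h x by apply: concave_distortion_ge_id; rewrite x0.
apply/eqP; rewrite eq_le xh andbT.
(* Given [h (1/2) <= 1/2], the decreasing slope of [h] yields [h x <= x] to the right of 1/2; to the
   left, the increasing slope of the dual, taken at [1 - x], does the same. *)
have [x2|/ltW x2] := leP x 2^-1; last first.
  have := @concave_distortion_ratio 2^-1 x; nra.
have := @dual_distortion_ratio 2^-1 (1 - x); rewrite /dual_distortion.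
have -> : 1 - 2^-1 = 2^-1 :> R by field.
rewrite subKr; nra.
Qed.

(** Compare slopes with those at 1/2: the dual at [x] is at most [2 x (1 - h (1/2))], whereas [h x]
    is at least [2 x h (1/2)]. *)
Lemma dual_distortion_le_half (x : R) : 0 <= x <= 2^-1 ->
  h 2^-1 * dual_distortion x <= (1 - h 2^-1) * h x.
Proof.
move=> /andP[x0 x2].
have := @dual_distortion_ratio x 2^-1 x0 x2; rewrite {2}/dual_distortion.
have -> : 1 - 2^-1 = 2^-1 :> R by field.
have := @concave_distortion_ratio x 2^-1 x0 x2.
have : 0 <= h 2^-1 <= 1 by apply: (distortion_itv ch.1); lra.
have : 2^-1 = 1 / 2 :> R by field.
move: (h 2^-1) (dual_distortion x) => a b; nra.
Qed.

End concave_distortion.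

(** * Tail functions of [X], [- X] and [|X|] *)

Section tail.
Context d (T : measurableType d) (R : realType) (P : probability T R).
Implicit Types X : {mfun T >-> R}.
Local Notation mu := (@lebesgue_measure R).

Definition tail X (x : R) : R := fine (P [set w | x < X w]).

Let mgt X x : measurable [set w | x < X w].
Proof.
rewrite [X in measurable X](_ : _ = X @^-1` `]x, +oo[).
  exact: measurable_funPTI.
by apply/seteqP; split => w /=; rewrite in_itv/= andbT.
Qed.

Lemma tail_itv X x : 0 <= tail X x <= 1.
Proof.
rewrite /tail fine_ge0//= -lee_fin fineK ?fin_num_measure//.
exact: probability_le1.
Qed.

Lemma tail_nonincreasing X : nonincreasing_fun (tail X).
Proof.
move=> x y xy; rewrite fine_le ?fin_num_measure// le_measure ?inE//.
by move=> w /=; exact: le_lt_trans.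
Qed.

(** For [x >= 0] the events [X > x] and [- X > x] are disjoint. *)
Lemma tailN_disj X x : 0 <= x -> tail X x + tail (- X) x <= 1.
Proof.
move=> x0; rewrite /tail -fineD ?fin_num_measure// -lee_fin fineK; last first.
  by rewrite fin_numD !fin_num_measure.
rewrite -measureU//; first exact/probability_le1/measurableU.
by rewrite -subset0 => w /= []; rewrite fctE; lra.
Qed.

Lemma tail_le_abs X x : tail X x <= tail (abs_rv X) x.
Proof.
rewrite fine_le ?fin_num_measure// le_measure ?inE//.
by move=> w /= /lt_le_trans; apply; exact: ler_norm.
Qed.

Lemma abs_rvN X : abs_rv (- X) = abs_rv X.
Proof. by apply/val_inj/funext => w /=; rewrite normrN. Qed.

Lemma tail_abs_le X x : tail (abs_rv X) x <= tail X x + tail (- X) x.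
Proof.
rewrite /tail -fineD ?fin_num_measure// fine_le ?fin_numD ?fin_num_measure//.
apply: le_trans (measureU2 _ _ _) => //; rewrite le_measure ?inE//.
  exact: measurableU.
by move=> w /=; rewrite ltr_normr => /orP.
Qed.

Lemma tailN_abs X x : 0 <= x -> tail (- abs_rv X) x = 0.
Proof.
move=> x0; rewrite /tail [X in P X](_ : _ = set0) ?measure0//.
rewrite -subset0 => w /=; rewrite ltNge => /negP; apply.
by rewrite fctE /= (le_trans _ x0)// oppr_le0.
Qed.

(** A law has countably many atoms, and countable sets are Lebesgue-null. This lets strict and weak
    tails be exchanged under the integral. *)
Lemma pmf_eq0_ae X : {ae mu, forall x, pmf (X : {RV P >-> R}) x = 0}.
Proof.
have cX := @pmf_gt0_countable _ _ _ P X.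
exists [set r | 0 < pmf (X : {RV P >-> R}) r]; split.
- exact: countable_measurable.
- exact: countable_lebesgue_measure0.
- by move=> r /= /eqP; rewrite lt_neqAle pmf_ge0 andbT eq_sym.
Qed.

(** The events [X > - x], [- X > x] and [- X = x] partition the space, and the last one is null. *)
Lemma tail_opp X x : pmf (- X : {RV P >-> R}) x = 0 ->
  tail X (- x) = 1 - tail (- X) x.
Proof.
rewrite /pmf => X0; have mX1 : measurable ((- X) @^-1` [set x]).
  exact: measurable_funPTI.
have : P (([set w | - x < X w] `|` [set w | x < (- X) w])
    `|` (- X) @^-1` [set x]) = 1%E.
  rewrite (_ : _ `|` _ = setT) ?probability_setT//.
  apply/seteqP; split => // w _ /=; rewrite fctE.
  by have [?|?|?] := ltgtP x (- X w); [left; right|left; left; lra|right].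
rewrite !measureU//=; last 4 first.
- exact: mgt.
- by rewrite -subset0 => w /= []; rewrite fctE; lra.
- by apply: measurableU => //; exact: mgt.
- by rewrite -subset0 => w /= []; rewrite fctE => -[]; lra.
move=> /(congr1 fine).
have mNX := mgt (- X) x.
by rewrite !fineD ?fin_numD ?fin_num_measure// X0 addr0 => /= <-; rewrite addrK.
Qed.

(** * Integrals of distorted tails: for a distortion [g], the Choquet integral of the positive part
    of [X] *)

Definition tail_integral (g : R -> R) X : \bar R :=
  (\int[mu]_(x in `[0%R, +oo[) (g (tail X x))%:E)%E.

Variable h : R -> R.
Hypothesis ch : concave_distortion h.

Local Notation Ih := (tail_integral h).
Local Notation Ih' := (tail_integral (dual_distortion h)).

Let h_mono (p q : R) : 0 <= p -> p <= q -> q <= 1 -> h p <= h q.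
Proof.
move=> p0 pq q1; apply: (distortion_mono ch.1) => //;
  by rewrite in_itv/=; apply/andP; split => //; lra.
Qed.

Lemma measurable_distortion_tail X :
  measurable_fun setT (fun x => (h (tail X x))%:E).
Proof.
apply/measurable_EFinP; apply: nonincreasing_measurable => // x y xy.
have /andP[? ?] := tail_itv X x; have /andP[? ?] := tail_itv X y.
by apply: h_mono => //; exact: tail_nonincreasing.
Qed.

Lemma measurable_dual_distortion_tail X :
  measurable_fun setT (fun x => (dual_distortion h (tail X x))%:E).
Proof.
apply/measurable_EFinP; apply: nonincreasing_measurable => // x y xy.
have /andP[? ?] := tail_itv X x; have /andP[? ?] := tail_itv X y.
rewrite lerD2l lerN2; apply: h_mono; [lra| |lra].
by rewrite lerD2l lerN2; exact: tail_nonincreasing.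
Qed.

(** Reflected by [x -> - x], the integral over the negative half-line has, up to sign, the integrand
    [1 - h (P (X > - x))]; off the atoms of [- X] this is the dual distortion of the tail of
    [- X]. *)
Lemma distortion_risk_measureE X :
  distortion_risk_measure P h X = (Ih X - Ih' (- X)%R)%E.
Proof.
rewrite /distortion_risk_measure; congr (_ + _)%E.
have hle1 x : h (tail X x) <= 1.
  by have /andP[] := distortion_itv ch.1 (tail_itv X x).
under eq_integral do rewrite -/(tail X _) -opprB EFinN.
rewrite integral_ge0N; last by move=> x _; rewrite lee_fin subr_ge0.
congr (- _)%E.
pose f (x : R) : \bar R := (1 - h (tail X (- x)))%:E.
have mf : measurable_fun setT f.
  apply/measurable_EFinP; apply: nonincreasing_measurable => // x y xy.
  rewrite lerD2l lerN2.
  have /andP[? ?] := tail_itv X (- x); have /andP[? ?] := tail_itv X (- y).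
  by apply: h_mono => //; apply: tail_nonincreasing; rewrite lerN2.
transitivity (\int[mu]_(x in `]-oo, 0%R]) f (- x)%R)%E.
  by apply: eq_integral => x _; rewrite /f opprK.
rewrite -(ge0_integration_by_substitution0 mf); last first.
  by move=> x; rewrite lee_fin subr_ge0.
apply: ge0_ae_eq_integral => //.
- exact: measurable_funTS.
- by apply: measurable_funTS; exact: measurable_dual_distortion_tail.
- by move=> x _; rewrite lee_fin subr_ge0.
- by move=> x _; rewrite lee_fin dual_distortion_ge0// tail_itv.
have [N [mN N0 NX]] := pmf_eq0_ae (- X).
exists N; split => //; apply: subset_trans NX => x /=; apply: contra_not => X0 _.
by rewrite /f /dual_distortion tail_opp.
Qed.

Let htail_itv X x : 0 <= h (tail X x) <= 1.
Proof. exact/(distortion_itv ch.1)/tail_itv. Qed.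

Lemma tail_integral_ge0 X : (0 <= Ih X)%E.
Proof.
by apply: integral_ge0 => x _; rewrite lee_fin; have /andP[] := htail_itv X x.
Qed.

Let Ih'_ge0 X : (0 <= Ih' X)%E.
Proof.
apply: integral_ge0 => x _; rewrite lee_fin.
exact/(dual_distortion_ge0 ch)/tail_itv.
Qed.

Let mhD X : measurable_fun (`[0%R, +oo[ : set R) (fun x => (h (tail X x))%:E).
Proof. by apply: measurable_funTS; exact: measurable_distortion_tail. Qed.

Let mh'D X : measurable_fun (`[0%R, +oo[ : set R)
  (fun x => (dual_distortion h (tail X x))%:E).
Proof. by apply: measurable_funTS; exact: measurable_dual_distortion_tail. Qed.

Let Ih'_le X : (Ih' X <= Ih X)%E.
Proof.
apply: ge0_le_integral => //.
- move=> x _; rewrite lee_fin; exact/(dual_distortion_ge0 ch)/tail_itv.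
- exact: mh'D.
- exact: mhD.
- move=> x _; rewrite lee_fin; exact/(dual_distortion_le ch)/tail_itv.
Qed.

Let Ih_le_abs X : (Ih X <= Ih (abs_rv X))%E.
Proof.
apply: ge0_le_integral => //.
- by move=> x _; rewrite lee_fin; have /andP[] := htail_itv X x.
- exact: mhD.
- exact: mhD.
move=> x _; rewrite lee_fin; have /andP[? _] := tail_itv X x.
have /andP[_ ?] := tail_itv (abs_rv X) x.
by apply: h_mono => //; exact: tail_le_abs.
Qed.

(** Union bound on the tails, then subadditivity of [h], which applies because disjointness keeps
    the sum of the two tails at most 1. *)
Let Ih_abs_le X : (Ih (abs_rv X) <= Ih X + Ih (- X)%R)%E.
Proof.
rewrite -ge0_integralD//; last 4 first.
- by move=> x _; rewrite lee_fin; have /andP[] := htail_itv X x.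
- exact: mhD.
- by move=> x _; rewrite lee_fin; have /andP[] := htail_itv (- X) x.
- exact: mhD.
apply: ge0_le_integral => //.
- by move=> x _; rewrite lee_fin; have /andP[] := htail_itv (abs_rv X) x.
- exact: mhD.
- by apply: emeasurable_funD; exact: mhD.
move=> x; rewrite /= in_itv/= andbT => x0; rewrite -EFinD lee_fin.
have /andP[? _] := tail_itv X x; have /andP[? _] := tail_itv (- X) x.
have /andP[? _] := tail_itv (abs_rv X) x; have ? := tailN_disj X x0.
apply: le_trans (concave_distortion_subadd ch _ _ _) => //.
by apply: h_mono => //; exact: tail_abs_le.
Qed.

(** [|X|] has no negative part, and the dual distortion is 0 at 0. *)
Lemma distortion_risk_measure_abs X :
  distortion_risk_measure P h (abs_rv X) = Ih (abs_rv X).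
Proof.
rewrite distortion_risk_measureE [Ih' _]/tail_integral.
rewrite (eq_integral (cst 0%E)); first by rewrite integral0 sube0.
move=> x; rewrite inE/= in_itv/= andbT => x0.
rewrite tailN_abs// /dual_distortion subr0 (distortion1 ch.1) subrr//.
Qed.

(** Tails decrease, so they stay in [[0, 1/2]] on the whole half-line and the pointwise comparison
    there can be integrated. *)
Let Ih'_half X : tail X 0 <= 2^-1 ->
  ((h 2^-1)%:E * Ih' X <= (1 - h 2^-1)%:E * Ih X)%E.
Proof.
move=> X2.
have /andP[h2 h21] : 0 <= h 2^-1 <= 1 by apply: (distortion_itv ch.1); lra.
rewrite -ge0_integralZl_EFin//; last 2 first.
- by move=> x _; rewrite lee_fin; exact/(dual_distortion_ge0 ch)/tail_itv.
- exact: mh'D.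
rewrite -ge0_integralZl_EFin ?subr_ge0//; last 2 first.
- by move=> x _; rewrite lee_fin; have /andP[] := htail_itv X x.
- exact: mhD.
apply: ge0_le_integral => //.
- move=> x _; rewrite -EFinM lee_fin mulr_ge0//.
  exact/(dual_distortion_ge0 ch)/tail_itv.
- by apply: measurable_funeM; exact: mh'D.
- by apply: measurable_funeM; exact: mhD.
move=> x; rewrite /= in_itv/= andbT => x0; rewrite -!EFinM lee_fin.
apply: (dual_distortion_le_half ch).
have /andP[-> _] /= := tail_itv X x.
by apply: le_trans X2; exact: tail_nonincreasing.
Qed.

Let Ih'_half_or X :
  ((h 2^-1)%:E * Ih' X <= (1 - h 2^-1)%:E * Ih X)%E \/
  ((h 2^-1)%:E * Ih' (- X)%R <= (1 - h 2^-1)%:E * Ih (- X)%R)%E.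
Proof.
have [/Ih'_half|X2] := leP (tail X 0) 2^-1; [by left|right; apply: Ih'_half].
by have := tailN_disj X (lexx 0); lra.
Qed.

(** [rho_h X] is a difference of two nonnegative terms, each at most the tail integral of [|X|]. *)
Lemma distortion_risk_measure_le_abs X :
  (`|distortion_risk_measure P h X|
    <= distortion_risk_measure P h (abs_rv X))%E.
Proof.
rewrite distortion_risk_measure_abs distortion_risk_measureE.
have XN : (Ih' (- X)%R <= Ih (abs_rv X))%E.
  by rewrite -abs_rvN; exact: le_trans (Ih'_le _) (Ih_le_abs _).
have := Ih'_ge0 (- X); have := tail_integral_ge0 X; move: XN (Ih_le_abs X).
move: (Ih X) (Ih' _) (Ih _) => [a| |] [b| |] [c| |] //=; rewrite ?leey//.
by rewrite !lee_fin ler_norml; lra.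
Qed.

Lemma distortion_risk_measure_folding X (m : R) :
  2^-1 < h 2^-1 ->
  (`|distortion_risk_measure P h X| <= m%:E)%E ->
  (`|distortion_risk_measure P h (- X)%R| <= m%:E)%E ->
  (distortion_risk_measure P h (abs_rv X)
    <= ((h 2^-1 * (4 * m)) / (2 * h 2^-1 - 1) + m)%:E)%E.
Proof.
rewrite distortion_risk_measure_abs !distortion_risk_measureE opprK => h2.
have /andP[_ h21] : 0 <= h 2^-1 <= 1 by apply: (distortion_itv ch.1); lra.
move: (Ih_abs_le X) (Ih'_half_or X).
have := Ih'_ge0 (- X); have := tail_integral_ge0 X; have := Ih'_le X.
have := Ih'_ge0 X; have := tail_integral_ge0 (- X); have := Ih'_le (- X).
move: (Ih (abs_rv X)) (Ih X) (Ih (- X)) (Ih' X) (Ih' (- X)) h2 h21.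
(* The real bound [m] rules out infinite integrals: even +oo - oo evaluates to -oo, whose absolute
   value exceeds [m]. *)
move: (h 2^-1) => e [c| |] [a| |] [b| |] [a'| |] [b'| |] //=;
  rewrite ?leNye//.
rewrite -!EFinD -!EFinM !lee_fin !ler_norml => e2 e1.
move=> b'b b0 a'a a'0 a0 b'0 cab H /andP[? ?] /andP[? ?].
rewrite -lerBlDr ler_pdivlMr; last by lra.
(* Say [e a' <= (1 - e) a]: then [a <= 2 m + a'] gives
   [(2 e - 1) a <= 2 e m], and [c <= a + b <= 2 a + m]. *)
by case: H; nra.
Qed.

End tail.

(** * Convex risk measures and the folding score *)

Lemma folding_ratio_le (R : realType) (a b : \bar R) (s m : R) :
  (0 <= a)%E -> (0 <= b)%E -> (b <= m%:E)%E -> 0 <= s ->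
  (folding_ratio a b <= s%:E)%E -> (a <= (s * m)%:E)%E.
Proof.
(* Here [b] is real, which excludes oo/oo. The case [a = 0] is trivial and absorbs 0/0; for [a > 0],
   [b = 0] would make the ratio +oo, and otherwise [a <= s b <= s m]. *)
move=> a0; case: b => [b| |]//; rewrite !lee_fin => b0 bm s0.
have sm0 : 0 <= s * m by rewrite mulr_ge0// (le_trans b0).
rewrite /folding_ratio andbF orbF; have [->|an0] := eqVneq a 0%E.
  by rewrite lee_fin.
have {an0}a0 : (0 < a)%E by rewrite lt_neqAle eq_sym an0.
rewrite /= inver; have [_|bn0] := eqVneq b 0; first by rewrite gt0_muley.
have {bn0}b0 : 0 < b by rewrite lt_neqAle eq_sym bn0.
rewrite lee_pdivrMr// => /le_trans; apply.
by rewrite -EFinM lee_fin ler_wpM2l.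
Qed.

Section convex_risk_measure.
Context d (T : measurableType d) (R : realType) (P : probability T R).
Variables (L : set {mfun T >-> R}) (rho : {mfun T >-> R} -> \bar R).
Hypotheses (coneL : rv_convex_cone P L) (rho_conv : convex_risk_measure P L rho).
Hypothesis rho0 : normalized rho.
Implicit Types X : {mfun T >-> R}.

Lemma convex_risk_abs_ge0 X : L (abs_rv X) -> (0 <= rho (abs_rv X))%E.
Proof.
move=> LX; rewrite -rho0; apply: (risk_monotone rho_conv) => //.
  exact: (cone_cst coneL).
by apply: aeW => w /=.
Qed.

(** Both [X] and [- X] lie below [|X|], and 0 is their midpoint, so that
    [- rho X <= rho (- X) <= rho |X|]. *)
Lemma convex_risk_le_abs X : L X -> L (- X) -> L (abs_rv X) ->
  (`|rho X| <= rho (abs_rv X))%E.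
Proof.
move=> LX LNX LaX.
have Xa : (rho X <= rho (abs_rv X))%E.
  by apply: (risk_monotone rho_conv) => //; apply: aeW => w /=; exact: ler_norm.
have NXa : (rho (- X)%R <= rho (abs_rv X))%E.
  rewrite -abs_rvN; apply: (risk_monotone rho_conv) => //.
    by rewrite abs_rvN.
  by apply: aeW => w /=; exact: ler_norm.
have half : 0 < (2^-1 : R) < 1 by lra.
have := risk_convex rho_conv LX LNX half.
have -> : 2^-1 *: X + (1 - 2^-1) *: - X = cst 0.
  apply/val_inj/funext => w /=; rewrite !fctE scalerN -scalerBl.
  by rewrite [X in X *: _](_ : _ = 0) ?scale0r//; lra.
rewrite rho0.
have := risk_gtNy (convex_risk_is_risk rho_conv) LX.
have := risk_gtNy (convex_risk_is_risk rho_conv) LNX.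
move: (rho _) (rho _) (rho _) Xa NXa => [a| |] [b| |] [c| |] //=;
  rewrite ?leey//.
by rewrite -!EFinM -EFinD !lee_fin ler_norml => *; lra.
Qed.

Lemma convex_risk_folding X (s m : R) : 0 <= s ->
  (folding_score L rho <= s%:E)%E ->
  L X -> L (- X) -> L (abs_rv X) ->
  (`|rho X| <= m%:E)%E -> (`|rho (- X)%R| <= m%:E)%E ->
  (rho (abs_rv X) <= (s * m)%:E)%E.
Proof.
move=> s0 hs LX LNX LaX Xm NXm.
apply: (@folding_ratio_le _ _ (maxe `|rho X| `|rho (- X)%R|)%E) => //.
- exact: convex_risk_abs_ge0.
- by rewrite ge_max Xm NXm.
- by apply: le_trans hs; apply: ereal_sup_ubound; exists X.
Qed.

End convex_risk_measure.

(** The argument shared by both halves of the theorem, with [a], [b], [c] standing for the risks of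
    [X], [- X] and [|X|]. Since [M] depends on [m] alone, the resulting bound is uniform over
    [S]. *)
Lemma bounded_for_fold (R : realType) (I : Type) (S : set I)
    (a b c : I -> \bar R) :
  (forall X, S X -> (0 <= c X)%E) ->
  (forall X, S X -> (`|a X| <= c X)%E /\ (`|b X| <= c X)%E) ->
  (forall m : R, exists M : R, forall X, S X ->
    (`|a X| <= m%:E)%E -> (`|b X| <= m%:E)%E -> (c X <= M%:E)%E) ->
  (bounded_for S a /\ bounded_for S b) <-> bounded_for S c.
Proof.
move=> c0 abc fold; split => [[[m1 am] [m2 bm]]|[m cm]].
  have [M cM] := fold (Num.max m1 m2); exists M => X SX.
  rewrite gee0_abs ?c0//; apply: cM => //.
    by apply: le_trans (am _ SX) _; rewrite lee_fin le_max lexx.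
  by apply: le_trans (bm _ SX) _; rewrite lee_fin le_max lexx orbT.
split; exists m => X SX; have := cm _ SX; rewrite gee0_abs ?c0//;
  by apply: le_trans; have [] := abc _ SX.
Qed.

Theorem proposition3p3 (d : measure_display) (T : measurableType d)
    (R : realType) (P : probability T R) (hP : atomless P) :
  (forall (L : set {mfun T >-> R}) (rho : {mfun T >-> R} -> \bar R)
      (S : set {mfun T >-> R}),
    rv_convex_cone P L ->
    convex_risk_measure P L rho ->
    normalized rho ->
    (folding_score L rho < +oo)%E ->
    (forall X, S X -> [/\ L X, L (- X) & L (abs_rv X)]) ->
    (bounded_for S rho /\ bounded_for S (fun X => rho (- X)))
    <-> bounded_for S (fun X => rho (abs_rv X)))
  /\
  (forall (h : R -> R) (S : set {mfun T >-> R}),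
    concave_distortion h ->
    ~ (forall x, 0 <= x <= 1 -> h x = x) ->
    S `<=` L1 P ->
    (bounded_for S (distortion_risk_measure P h)
      /\ bounded_for S (fun X => distortion_risk_measure P h (- X)))
    <-> bounded_for S (fun X => distortion_risk_measure P h (abs_rv X))).
Proof.
split=> [L rho S coneL rho_conv rho0 sfin LS|h S ch hid _].
  apply: bounded_for_fold => [X /LS[]|X /LS[LX LNX LaX]|m].
  - by move=> _ _; exact: convex_risk_abs_ge0 coneL rho_conv rho0 _.
  - split; first exact: convex_risk_le_abs rho_conv rho0 _ _ _ _.
    by rewrite -abs_rvN; apply: (convex_risk_le_abs rho_conv rho0);
      rewrite ?abs_rvN// opprK.
  - have [s s0 hs] : exists2 s : R, 0 <= s & (folding_score L rho <= s%:E)%E.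
      (* [fine] returns the score if it is real, and 0 if it is -oo, where any real is an upper
         bound. *)
      exists (Num.max 0 (fine (folding_score L rho))).
        by rewrite le_max lexx.
      move: sfin; case: (folding_score _ _) => [r| |]//= _; rewrite ?leNye//.
      by rewrite lee_fin le_max lexx orbT.
    exists (s * m) => X /LS[LX LNX LaX].
    exact: (convex_risk_folding coneL rho_conv rho0).
(* The case of [rho_h] does not pass through the first half: both dominations come directly from the
   tail integral estimates. *)
apply: bounded_for_fold => [X _|X _|m].
- by rewrite distortion_risk_measure_abs// tail_integral_ge0.
- split; first exact: distortion_risk_measure_le_abs.
  by rewrite -abs_rvN; exact: distortion_risk_measure_le_abs.
- exists ((h 2^-1 * (4 * m)) / (2 * h 2^-1 - 1) + m) => X _.
  exact/distortion_risk_measure_folding/concave_distortion_half.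
Qed.
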